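(* Let $n\ge2$ and let $L_n$ be the lattice of arithmetic progressions in $[n]$. Then $L_n$ is complemented if and only if $n-1$ is squarefree. In particular, if $n-1$ is not squarefree, there exists an element $x\in L_n$ with $x\notin\{\emptyset,[n]\}$ whose only upper semicomplement is $[n]$.
   Context: $L_n$ is the set of all subsets of $[n]=\{1,\ldots,n\}$ that are arithmetic progressions $\{a,a+r,\ldots,a+(k-1)r\}$ ($a$, $r\ge1$, $k\ge0$ integers; including $\emptyset$, singletons and $2$-element subsets), ordered by inclusion; it is a lattice with minimum $\emptyset$, maximum $[n]$, meet given by intersection and join given by the smallest progression containing both. A lattice with minimum $\hat0$ and maximum $\hat1$ is complemented if for every $x$ there is $y$ with $x\vee y=\hat1$ and $x\wedge y=\hat0$. An upper semicomplement of $x$ is an element $y$ with $x\vee y=\hat1$. *)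

(* Defs.v *)
From HB Require Import structures.
From mathcomp Require Import all_boot all_order zify.

Set Implicit Arguments.
Unset Strict Implicit.
Unset Printing Implicit Defensive.

Import Order.TTheory.
Local Open Scope nat_scope.
Local Open Scope order_scope.

Definition squarefree (m : nat) : Prop :=
  forall d : nat, (d ^ 2 %| m)%N -> d = 1%N.

Section Complements.
Context {d : Order.disp_t} {L : tbLatticeType d}.

Definition upper_semicomplement (x y : L) : Prop := x `|` y = \top.

Definition complement (x y : L) : Prop := x `|` y = \top /\ x `&` y = \bot.

End Complements.

Definition complemented (d : Order.disp_t) (L : tbLatticeType d) : Prop :=
  forall x : L, exists y : L, complement x y.

Definition arith_prog (a r k : nat) : seq nat :=
  [seq (a + j * r)%N | j <- iota 0 k].

(* The ordinal [i : 'I_n] stands for the point [i.+1] of [{1, ..., n}]. *)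
Definition points (n : nat) (A : {set 'I_n}) : seq nat :=
  [seq (nat_of_ord i).+1 | i in A].

(* A natural [a] is enough: either [k = 0], or [a] is a point of [A]. *)
Definition is_progression (n : nat) (A : {set 'I_n}) : Prop :=
  exists a r k : nat, (0 < r)%N /\ points A =i arith_prog a r k.

(* Decidable form of [is_progression], with bounded parameters and common
   difference [r.+1]; see [progressionP]. *)
Definition progression (n : nat) (A : {set 'I_n}) : bool :=
  [exists a : 'I_n.+1, exists r : 'I_n.+1, exists k : 'I_n.+1,
     points A == arith_prog a r.+1 k].

Section ProgressionTheory.
Local Open Scope nat_scope.

Lemma mem_arith_prog a r k x : 0 < r ->
  (x \in arith_prog a r k) = [&& a <= x, x < a + k * r & r %| x - a].
Proof.
move=> r0; apply/mapP/and3P => [[j]|[ax xk /dvdnP[j xj]]].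
  rewrite mem_iota add0n => /= jk ->; rewrite leq_addr addKn dvdn_mull //.
  by split=> //; rewrite ltn_add2l ltn_pmul2r.
exists j; last by rewrite -xj subnKC.
by rewrite mem_iota add0n /= -(ltn_pmul2r r0) -xj; lia.
Qed.

Lemma sorted_arith_prog a r k : 0 < r -> sorted ltn (arith_prog a r k).
Proof.
move=> r0; rewrite /arith_prog sorted_map.
apply: (@sub_sorted _ ltn); last exact: iota_ltn_sorted.
by move=> i j /= ij; rewrite ltn_add2l ltn_pmul2r.
Qed.

Lemma mem_points n (A : {set 'I_n}) (i : 'I_n) : (i.+1 \in points A) = (i \in A).
Proof.
apply/imageP/idP => [[j jA [ij]]|iA]; last by exists i.
by rewrite (val_inj ij).
Qed.

Lemma pointsP n (A : {set 'I_n}) x :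
  reflect (exists2 i : 'I_n, i \in A & x = i.+1) (x \in points A).
Proof. exact: imageP. Qed.

Lemma sorted_points n (A : {set 'I_n}) : sorted ltn (points A).
Proof.
rewrite /points /image_mem sorted_map /enum_mem.
apply: (@sorted_filter _ (relpre (fun i : 'I_n => i.+1) ltn)).
  by move=> y x z /=; apply: ltn_trans.
rewrite -enumT.
have -> : sorted (relpre (fun i : 'I_n => i.+1) ltn) (enum 'I_n)
        = sorted ltn (map val (enum 'I_n)) by rewrite sorted_map.
by rewrite val_enum_ord iota_ltn_sorted.
Qed.

Lemma progressionP n (A : {set 'I_n}) :
  reflect (is_progression A) (progression A).
Proof.
apply: (iffP idP) => [/existsP[a /existsP[r /existsP[k /eqP E]]]|].
  by exists a, r.+1, k; rewrite E.
case=> a [r [k [r0 E]]].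
suff [a' [r' [k' [a'n r'n k'n E']]]] : exists a' r' k',
    [/\ a' < n.+1, r' < n.+1, k' < n.+1 & points A = arith_prog a' r'.+1 k'].
  apply/existsP; exists (Ordinal a'n); apply/existsP; exists (Ordinal r'n).
  by apply/existsP; exists (Ordinal k'n); apply/eqP.
have {}E : points A = arith_prog a r k.
  apply: (irr_sorted_eq ltn_trans ltnn) => //; first exact: sorted_points.
  exact: sorted_arith_prog.
have kn : k < n.+1.
  have : size (points A) = k by rewrite E size_map size_iota.
  rewrite size_image => <-.
  by rewrite ltnS -[leqRHS]card_ord max_card.
have bnd x : x \in arith_prog a r k -> x < n.+1.
  by rewrite -E => /pointsP[i _ ->]; rewrite ltnS.
case: k => [|[|k]] in E kn bnd *.
- by exists 0, 0, 0.
- exists a, 0, 1; split=> //.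
  by apply: bnd; rewrite mem_arith_prog // leqnn subnn dvdn0; lia.
- exists a, r.-1, k.+2; rewrite prednK //; split=> //.
    by apply: bnd; rewrite mem_arith_prog // leqnn subnn dvdn0; lia.
  suff /bnd : a + r \in arith_prog a r k.+2 by lia.
  by rewrite mem_arith_prog // addKn dvdnn leq_addr; lia.
Qed.

Lemma progression0 n : progression (set0 : {set 'I_n}).
Proof.
apply/progressionP; exists 0, 1, 0; split=> // x.
by apply/idP; case/pointsP=> i; rewrite inE.
Qed.

Lemma progressionT n : progression (setT : {set 'I_n}).
Proof.
apply/progressionP; exists 1, 1, n; split=> // x.
rewrite mem_arith_prog // dvd1n andbT muln1 add1n ltnS.
apply/pointsP/andP => [[i _ ->]|[x0 xn]]; first by rewrite ltn_ord.
have xn' : x.-1 < n by lia.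
by exists (Ordinal xn'); rewrite ?inE //= prednK.
Qed.

Lemma subn_shift a m x : a <= m -> m <= x -> x - m = (x - a) - (m - a).
Proof. lia. Qed.

Lemma addn_shift a m x : a <= m -> m <= x -> (x - m) + (m - a) = x - a.
Proof. lia. Qed.

Lemma progressionI n (A B : {set 'I_n}) :
  progression A -> progression B -> progression (A :&: B).
Proof.
move=> /progressionP[a1 [r1 [k1 [r10 E1]]]] /progressionP[a2 [r2 [k2 [r20 E2]]]].
have EI x : (x \in points (A :&: B)) = (x \in points A) && (x \in points B).
  apply/pointsP/andP => [[i]|[/pointsP[i iA ->]]].
    by rewrite inE => /andP[iA iB] ->; rewrite !mem_points.
  by rewrite mem_points => iB; exists i; rewrite // inE iA.
have [/eqP AB0|/set0Pn[i0 i0AB]] := boolP (A :&: B == set0).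
  by rewrite AB0 progression0.
have ex : exists x, x \in points (A :&: B) by exists i0.+1; rewrite mem_points.
case: (ex_minnP ex) => m mAB mmin; apply/progressionP.
pose R := lcmn r1 r2; pose H := minn (a1 + k1 * r1) (a2 + k2 * r2).
have R0 : 0 < R by rewrite lcmn_gt0 r10.
exists m, R, ((H - m + R.-1) %/ R); split=> // x.
move: (mAB); rewrite EI E1 E2 !mem_arith_prog //.
case/andP=> /and3P[m1 m1' m1d] /and3P[m2 m2' m2d].
have main : (x \in points (A :&: B)) = [&& m <= x, x < H & R %| x - m].
  apply/idP/and3P => [xAB|[mx xH]].
    have mx := mmin _ xAB; move: xAB; rewrite EI E1 E2 !mem_arith_prog //.
    case/andP=> /and3P[x1 x1' x1d] /and3P[x2 x2' x2d].
    split=> //; first by rewrite /H leq_min x1' x2'.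
    rewrite dvdn_lcm; apply/andP; split.
      by rewrite (subn_shift m1 mx) dvdn_sub.
    by rewrite (subn_shift m2 mx) dvdn_sub.
  rewrite dvdn_lcm => /andP[d1 d2]; move: xH; rewrite leq_min => /andP[h1 h2].
  rewrite EI E1 E2 !mem_arith_prog // h1 h2 (leq_trans m1 mx) (leq_trans m2 mx).
  by rewrite -(addn_shift m1 mx) -(addn_shift m2 mx) !dvdn_add.
rewrite main; case mx : (m <= x) => //=.
case d : (R %| x - m); rewrite ?andbF // !andbT.
have [j xj] := dvdnP d.
rewrite -[in RHS](subnKC mx) ltn_add2l xj ltn_pmul2r // leq_divRL //.
rewrite mulSn; clear -mx R0 xj; lia.
Qed.

End ProgressionTheory.

Definition APlattice (n : nat) : Type := {A : {set 'I_n} | progression A}.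

HB.instance Definition _ (n : nat) := SubType.on (APlattice n).
HB.instance Definition _ (n : nat) := Finite.on (APlattice n).

Section APlatticeOrder.
Variable n : nat.
Implicit Types x y z : APlattice n.

Definition ap_le x y : bool := val x \subset val y.

Lemma ap_le_refl : reflexive ap_le.
Proof. by move=> x; exact: subxx. Qed.

Lemma ap_le_anti : antisymmetric ap_le.
Proof.
by move=> x y /andP[xy yx]; apply/val_inj/eqP; rewrite eqEsubset; apply/andP.
Qed.

Lemma ap_le_trans : transitive ap_le.
Proof. by move=> y x z; exact: subset_trans. Qed.

Definition ap_meet x y : APlattice n :=
  exist _ (val x :&: val y) (progressionI (valP x) (valP y)).

Definition ap_hull (A : {set 'I_n}) : {set 'I_n} :=
  \bigcap_(B : {set 'I_n} | progression B && (A \subset B)) B.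

Lemma progression_hull (A : {set 'I_n}) : progression (ap_hull A).
Proof.
apply: (big_ind (fun B => progression B)) => [|B C|B /andP[]//].
- exact: progressionT.
- exact: progressionI.
Qed.

Definition ap_join x y : APlattice n :=
  exist _ (ap_hull (val x :|: val y)) (progression_hull _).

Lemma ap_meetP x y z : ap_le x (ap_meet y z) = ap_le x y && ap_le x z.
Proof. exact: subsetI. Qed.

Lemma ap_joinP x y z : ap_le (ap_join x y) z = ap_le x z && ap_le y z.
Proof.
rewrite /ap_le -subUset; apply/idP/idP => [h|h].
  by apply: subset_trans h; apply/bigcapsP => B /andP[].
by apply: bigcap_inf; rewrite h (valP z).
Qed.

Definition ap_bot : APlattice n := exist _ set0 (progression0 n).
Definition ap_top : APlattice n := exist _ setT (progressionT n).

Lemma ap_le0 x : ap_le ap_bot x. Proof. exact: sub0set. Qed.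
Lemma ap_le1 x : ap_le x ap_top. Proof. exact: subsetT. Qed.

End APlatticeOrder.

Fact ap_display : Order.disp_t. Proof. exact: Order.Disp tt tt. Qed.

HB.instance Definition _ (n : nat) :=
  Order.Le_isPOrder.Build ap_display (APlattice n)
    (@ap_le_refl n) (@ap_le_anti n) (@ap_le_trans n).
HB.instance Definition _ (n : nat) :=
  Order.POrder_MeetJoin_isLattice.Build ap_display (APlattice n)
    (@ap_meetP n) (@ap_joinP n).
HB.instance Definition _ (n : nat) :=
  Order.hasBottom.Build ap_display (APlattice n) (@ap_le0 n).
HB.instance Definition _ (n : nat) :=
  Order.hasTop.Build ap_display (APlattice n) (@ap_le1 n).

Lemma ap_leE n (x y : APlattice n) : (x <= y) = (val x \subset val y).
Proof. by []. Qed.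

Lemma val_ap_meet n (x y : APlattice n) : val (x `&` y) = val x :&: val y.
Proof. by []. Qed.

Lemma val_ap_join n (x y : APlattice n) :
  val (x `|` y) = ap_hull (val x :|: val y).
Proof. by []. Qed.

Lemma val_ap_bot n : val (\bot : APlattice n) = set0.
Proof. by []. Qed.

Lemma val_ap_top n : val (\top : APlattice n) = setT.
Proof. by []. Qed.

(* Main.v *)
(** Shift [[n]] to [{0, ..., N}] with [N = n - 1].  If [d ^ 2 %| N] with
    [d > 1], then [x = {N / d}] misses both ends, so an upper semicomplement
    contains [0] and [N] and has a difference [s] dividing [N] and coprime to
    [N / d]; every prime factor of [N] divides [N / d], hence [s = 1].
    Conversely, let [N] be squarefree and let [x] have first element [a] and
    difference [r].  If [x] contains an end of [{0, ..., N}], a progression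
    with at most two elements is a complement.  Otherwise the multiples of
    some divisor [s] of [N] form a complement: with [h = gcd (N, r)], take
    [s = N / h] if [h] divides [a] and [s = h / gcd (h, a)] if not. *)

Require Import Defs.
From mathcomp Require Import all_boot all_order.
From mathcomp Require Import zify.

Set Implicit Arguments.
Unset Strict Implicit.
Unset Printing Implicit Defensive.

Import Order.TTheory.
Local Open Scope order_scope.

(** * Progressions and divisibility on {0, ..., N} *)

Section Progressions.
Local Open Scope nat_scope.

Lemma progression_ord n (A : {set 'I_n}) : progression A ->
  exists a r k, [/\ 0 < r, all (gtn n) (arith_prog a r k) &
    forall i : 'I_n, (i \in A) = (val i \in arith_prog a r k)].
Proof.
move=> /progressionP[a [r [k [r0 E]]]].
(* A nonempty progression starts at a point, so shifting its start to [a.-1] loses nothing; an empty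
   one may have [a = 0]. *)
have a0 : 0 < k -> 0 < a.
  move=> k0; have : a \in points A.
    by rewrite E mem_arith_prog // leqnn subnn dvdn0; nia.
  by case/pointsP=> i _ ->.
have mS x : (x \in arith_prog a.-1 r k) = (x.+1 \in arith_prog a r k).
  rewrite !mem_arith_prog //.
  case: k a0 {E} => [|k] a0; first by rewrite mul0n; lia.
  case: a a0 => [/(_ isT)//|a _] /=.
  by rewrite ltnS subSS addSn ltnS.
exists a.-1, r, k; split=> // [|i]; last by rewrite mS -E mem_points.
by apply/allP=> x; rewrite mS -E => /pointsP[i _ [->]] /=.
Qed.

Lemma ex_ap n a r k : 0 < r -> all (gtn n) (arith_prog a r k) ->
  exists y : APlattice n,
    forall i : 'I_n, (i \in val y) = (val i \in arith_prog a r k).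
Proof.
move=> r0 /allP bnd.
have P : progression [set i : 'I_n | val i \in arith_prog a r k].
  apply/progressionP; exists a.+1, r, k; split=> // x.
  have mS z : (z.+1 \in arith_prog a.+1 r k) = (z \in arith_prog a r k).
    by rewrite !mem_arith_prog // ltnS subSS addSn ltnS.
  apply/pointsP/idP => [[i]|]; first by rewrite inE -mS => ? ->.
  case: x => [|x]; first by rewrite mem_arith_prog.
  rewrite mS => xin; exists (Ordinal (bnd _ xin)) => //.
  by rewrite inE.
by exists (exist (@progression n) _ P) => i; rewrite inE.
Qed.

Lemma ex_ap_interval n a b : b <= n ->
  exists y : APlattice n, forall i : 'I_n, (i \in val y) = (a <= i < b).
Proof.
move=> bn; have [|y yE] := @ex_ap n a 1 (b - a) isT.
  by apply/allP=> x; rewrite mem_arith_prog //= => /and3P[]; lia.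
exists y => i; rewrite yE mem_arith_prog // dvd1n andbT muln1 /=.
by lia.
Qed.

Lemma ex_ap_multiples N s : 0 < s -> s %| N ->
  exists y : APlattice N.+1, forall i : 'I_N.+1, (i \in val y) = (s %| i).
Proof.
move=> s0 /dvdnP[q Nq]; have [|y yE] := @ex_ap N.+1 0 s q.+1 s0.
  apply/allP=> x; rewrite mem_arith_prog //= => /andP[xl].
  rewrite subn0 => /dvdnP[j xj]; move: xl.
  by rewrite add0n xj ltn_pmul2r // Nq !ltnS leq_pmul2r.
exists y => i; rewrite yE mem_arith_prog // subn0 /=.
by have := ltn_ord i; rewrite add0n mulSn -Nq; case: (s %| i); lia.
Qed.

(** The square of the gcd divides [N %/ h * h], which is [N]. *)
Lemma coprime_divn_squarefree N h : 0 < N -> squarefree N -> h %| N ->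
  coprime (N %/ h) h.
Proof.
move=> N0 sqN hN; apply/eqP/sqN.
by rewrite expnS expn1 -[X in _ %| X](divnK hN) dvdn_mul ?dvdn_gcdl ?dvdn_gcdr.
Qed.

End Progressions.

(** * Joins equal to the top *)

Section Join.
Local Open Scope nat_scope.
Variable N : nat.
Implicit Types x y z : APlattice N.+1.

Lemma ap_eq_top y : (forall i, i \in val y) -> y = \top :> APlattice N.+1.
Proof. by move=> yT; apply/val_inj/setP=> i; rewrite val_ap_top inE yT. Qed.

(** Containing 0 forces the start to be 0; containing [N] then makes the difference divide [N] and
    the length reach [N]. *)
Lemma ap_ends y : ord0 \in val y -> ord_max \in val y ->
  exists s, [/\ 0 < s, s %| N & forall i, (i \in val y) = (s %| i)].
Proof.
have [a [r [k [r0 _ E]]]] := progression_ord (valP y).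
rewrite !E !mem_arith_prog //= leqn0 => /and3P[/eqP a0 _ _].
rewrite a0 subn0 add0n => /and3P[_ Nk rN]; exists r; split=> // i.
rewrite E a0 mem_arith_prog // subn0 add0n (leq_ltn_trans _ Nk) //.
by rewrite -ltnS ltn_ord.
Qed.

(** The join contains both ends, so it consists of the multiples of some [s]; this [s] divides all
    elements of the union, hence [s = 1]. *)
Lemma ap_complement x y :
    (forall i, i \in val x -> i \notin val y) ->
    ord0 \in val x :|: val y -> ord_max \in val x :|: val y ->
    (forall g, (forall i, i \in val x :|: val y -> g %| i) -> g = 1) ->
  complement x y.
Proof.
move=> dis x0 xN gcd1; split; last first.
  apply/val_inj/setP=> i; rewrite val_ap_meet val_ap_bot !inE.
  by apply/negP=> /andP[/dis/negP].
have sub i : i \in val x :|: val y -> i \in val (x `|` y)%O.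
  move: i; apply/subsetP; rewrite subUset -!ap_leE.
  by rewrite leUl leUr.
have [s [_ _ sE]] := ap_ends (sub _ x0) (sub _ xN).
apply: ap_eq_top => i; rewrite sE (gcd1 s) ?dvd1n // => j /sub.
by rewrite sE.
Qed.

(** Used with a proper progression [z] and a missing point [i] to refute that [z] covers [x] and
    [y]. *)
Lemma join_top_sub x y z i : upper_semicomplement x y ->
  (forall j, j \in val x :|: val y -> j \in val z) -> i \in val z.
Proof.
move=> xy /subsetP; rewrite subUset -!ap_leE -leUx xy ap_leE val_ap_top.
by move/subsetP; apply; rewrite inE.
Qed.

Lemma unique_upper_semicomplement d : 0 < N -> d ^ 2 %| N -> d != 1 ->
  exists x, [/\ x <> \bot, x <> \top &
    forall y, upper_semicomplement x y <-> y = \top].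
Proof.
move=> N0 /dvdnP[q Nq] d1.
pose m := q * d; have Nm : N = m * d by rewrite Nq /m; lia.
have m0 : 0 < m by case: m Nm; lia.
have mN : m < N by case: d {Nq} @m d1 Nm m0 => [|[|d]] //= _; nia.
have [//|x xE] := @ex_ap_interval N.+1 m m.+1; first lia.
have mo : m < N.+1 by lia.
have {}xE i : (i \in val x) = (i == Ordinal mo).
  by rewrite xE -val_eqE /=; lia.
exists x; split=> [xb|xt|y].
- by have := xE (Ordinal mo); rewrite xb val_ap_bot inE eqxx.
- have := xE ord0; rewrite xt val_ap_top inE -val_eqE /=; lia.
split=> [xy|->]; last by rewrite /upper_semicomplement joinx1.
(* Otherwise {1, ..., N} would contain both [x] and [y]; symmetrically for [N] and {0, ..., N - 1}
   below. *)
have y0 : ord0 \in val y.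
  have [//|z zE] := @ex_ap_interval N.+1 1 N.+1.
  apply: contraT => yN0; have := @join_top_sub x y z ord0 xy.
  rewrite zE; apply=> j; rewrite zE inE xE ltn_ord andbT.
  case/orP=> [/eqP-> //|]; apply: contraLR; rewrite lt0n negbK => /eqP j0.
  by rewrite (_ : j = ord0) //; apply/val_inj.
have yN : ord_max \in val y.
  have [|z zE] := @ex_ap_interval N.+1 0 N; first lia.
  apply: contraT => yNN; have := @join_top_sub x y z ord_max xy.
  rewrite zE ltnn andbF; apply=> j; rewrite zE inE xE /=.
  case/orP=> [/eqP-> //|]; apply: contraLR => jN.
  rewrite (_ : j = ord_max) //; apply/val_inj => /=.
  by have := ltn_ord j; lia.
have [s [s0 sN sE]] := ap_ends y0 yN.
(* The multiples of [gcdn s m] contain [x] and [y], hence also the point 1. *)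
have sm : coprime s m.
  have g0 : 0 < gcdn s m by rewrite gcdn_gt0 s0.
  have [|z zE] := @ex_ap_multiples N (gcdn s m) g0.
    exact: dvdn_trans (dvdn_gcdl _ _) sN.
  have o1 : 1 < N.+1 by [].
  have := @join_top_sub x y z (Ordinal o1) xy.
  rewrite zE dvdn1; apply=> j; rewrite zE inE xE sE.
  case/orP=> [/eqP->|sj]; first exact: dvdn_gcdr.
  exact: dvdn_trans (dvdn_gcdl _ _) sj.
have s1 : s = 1.
  (* Coprimality to [m] pushes [s] into [d], which divides [m = q * d]; so [s] divides
     [gcdn s m = 1]. *)
  have sd : s %| d by move: sN; rewrite Nm Gauss_dvdr.
  have : s %| gcdn s m by rewrite dvdn_gcd dvdnn dvdn_mull.
  by rewrite (eqP sm) dvdn1 => /eqP.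
by apply: ap_eq_top => i; rewrite sE s1 dvd1n.
Qed.

(** * Complements of progressions containing an end *)

Lemma ap_complement_left x : 0 < N ->
  ord0 \in val x -> ord_max \notin val x -> exists y, complement x y.
Proof.
move=> N0 x0 xN; have oN : N.-1 < N.+1 by lia.
(* The complement is {N} or {N - 1, N}: disjoint from [x], and the union contains the coprime
   numbers [N.-1] and [N]. *)
pose b := if Ordinal oN \in val x then N else N.-1.
have [//|y yE] := @ex_ap_interval N.+1 b N.+1.
exists y; apply: ap_complement => [i ix||| g gx].
- rewrite yE ltn_ord andbT -ltnNge.
  have iN : i != N :> nat.
    by apply: contra xN => /eqP iN; rewrite (_ : ord_max = i) //; apply/val_inj.
  have := ltn_ord i; rewrite /b; case: ifP => [_|/negP nx]; first lia.
  suff : i != N.-1 :> nat by lia.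
  by apply/eqP=> iN1; apply: nx; rewrite (_ : Ordinal oN = i) //; apply/val_inj.
- by rewrite inE x0.
- by rewrite inE yE /= /b; case: ifP; lia.
have gN : g %| N.
  by apply: (gx ord_max); rewrite inE yE /= /b; case: ifP; lia.
have gN1 : g %| N.-1.
  apply: (gx (Ordinal oN)); rewrite inE yE /= /b.
  by case: ifP => //= _; lia.
by apply/eqP; rewrite -dvdn1 -(dvdn_addr _ gN1) addn1 prednK.
Qed.

Lemma ap_complement_right x : 0 < N ->
  ord_max \in val x -> ord0 \notin val x -> exists y, complement x y.
Proof.
move=> N0 xN x0; have o1 : 1 < N.+1 by lia.
(* The complement is {0} or {0, 1}, so that the union contains 1. *)
pose b := if Ordinal o1 \in val x then 1 else 2.
have [|y yE] := @ex_ap_interval N.+1 0 b; first by rewrite /b; case: ifP; lia.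
exists y; apply: ap_complement => [i ix||| g gx].
- rewrite yE /= -leqNgt.
  have i0 : i != 0 :> nat.
    by apply: contra x0 => /eqP i0; rewrite (_ : ord0 = i) //; apply/val_inj.
  rewrite /b; case: ifP => [_|/negP nx]; first lia.
  suff : i != 1 :> nat by lia.
  by apply/eqP=> i1; apply: nx; rewrite (_ : Ordinal o1 = i) //; apply/val_inj.
- by rewrite inE yE /= /b orbC; case: ifP.
- by rewrite inE xN.
apply/eqP; rewrite -dvdn1; apply: (gx (Ordinal o1)).
by rewrite inE yE /= /b; case: ifP.
Qed.

Lemma ap_complement_ends x : 0 < N ->
  ord0 \in val x -> ord_max \in val x -> exists y, complement x y.
Proof.
move=> N0 x0 xN; have [s [s0 sN sE]] := ap_ends x0 xN.
have o1 : 1 < N.+1 by lia.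
case: (eqVneq s 1) => [s1|s1].
  exists \bot; rewrite /complement joinx0 meetx0; split=> //.
  by apply: ap_eq_top => i; rewrite sE s1 dvd1n.
(* Since [s] does not divide 1, the singleton {1} misses [x]. *)
have [//|y yE] := @ex_ap_interval N.+1 1 2.
exists y; apply: ap_complement => [i||| g gx].
- rewrite sE yE; apply: contraL => i1.
  by rewrite (_ : i = 1 :> nat) ?dvdn1 //; lia.
- by rewrite inE x0.
- by rewrite inE xN.
apply/eqP; rewrite -dvdn1; apply: (gx (Ordinal o1)).
by rewrite inE yE orbT.
Qed.

(** * Complements of progressions missing both ends *)

(** The multiples of [s] include 0, [N] and [s] itself, so a common divisor of the union divides
    [s]. *)
Lemma ap_complement_multiples x s : 0 < N -> s %| N ->
    (forall i, i \in val x -> ~~ (s %| i)) ->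
    (forall g, g %| s -> (forall i, i \in val x -> g %| i) -> g = 1) ->
  exists y, complement x y.
Proof.
move=> N0 sN nx gcd1; have [y yE] := ex_ap_multiples (dvdn_gt0 N0 sN) sN.
exists y; apply: ap_complement => [i /nx||| g gx].
- by rewrite yE.
- by rewrite inE yE dvdn0 orbT.
- by rewrite inE yE /= sN orbT.
apply: gcd1 => [|i ix]; last by apply: gx; rewrite inE ix.
have so : s < N.+1 by rewrite ltnS dvdn_leq.
by apply: (gx (Ordinal so)); rewrite inE yE /= dvdnn orbT.
Qed.

(* A singleton [{a}] has no difference of its own; [r = a] is then the choice
   for which [r] divides every common divisor of the elements. *)
Lemma ap_difference x i0 : i0 \in val x -> ord0 \notin val x ->
  exists a r, [/\ 0 < r, forall i, i \in val x -> a <= i /\ r %| i - a &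
    forall g, (forall i, i \in val x -> g %| i) -> g %| a /\ g %| r].
Proof.
have [a [r [k [r0 /allP kn E]]]] := progression_ord (valP x).
move=> xi0 x0.
have mem j : j < k -> exists2 i : 'I_N.+1, i \in val x & val i = a + j * r.
  move=> jk; have jin : a + j * r \in arith_prog a r k.
    by apply/mapP; exists j; rewrite ?mem_iota.
  by exists (Ordinal (kn _ jin)); rewrite ?E.
case: k => [|k] in E kn mem *; first by rewrite E in xi0.
have [ia iax iaE] := mem 0 isT; rewrite addn0 in iaE.
case: k => [|k] in E kn mem *.
  have xa i : i \in val x -> val i = a.
    by rewrite E inE addn0 => /eqP.
  exists a, a; split=> [|i /xa->|g /(_ _ iax)]; first last.
  - by rewrite iaE.
  - by rewrite subnn.
  rewrite lt0n; apply: contra x0 => /eqP a_0.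
  by rewrite (_ : ord0 = ia) //; apply/val_inj; rewrite iaE.
have [ir irx irE] := mem 1 isT; rewrite mul1n in irE.
exists a, r; split=> // [i|g gx].
  by rewrite E mem_arith_prog // => /and3P[].
have ga := gx _ iax; have := gx _ irx; rewrite iaE in ga.
by rewrite irE dvdn_addr.
Qed.

Lemma ap_complement_interior x i0 : 0 < N -> squarefree N ->
  i0 \in val x -> ord0 \notin val x -> ord_max \notin val x ->
  exists y, complement x y.
Proof.
move=> N0 sqN xi0 x0 xN.
have [a [r [r0 xar gar]]] := ap_difference xi0 x0.
have bnd i : i \in val x -> 0 < i < N.
  move=> ix; apply/andP; split.
    rewrite lt0n; apply: contra x0 => /eqP i_0.
    by rewrite (_ : ord0 = i) //; apply/val_inj.
  rewrite ltn_neqAle -ltnS ltn_ord andbT; apply: contra xN => /eqP i_N.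
  by rewrite (_ : ord_max = i) //; apply/val_inj.
pose h := gcdn N r.
have hN : h %| N := dvdn_gcdl _ _.
have hr : h %| r := dvdn_gcdr _ _.
have cop m : m %| N -> forall g, g %| N %/ m -> g %| m -> g = 1.
  move=> mN g gNm gm; apply/eqP; rewrite -dvdn1.
  by rewrite -(eqP (coprime_divn_squarefree N0 sqN mN)) dvdn_gcd gNm.
have [ha|ha] := boolP (h %| a).
  apply: (@ap_complement_multiples x (N %/ h)) => // [|i ix|g gs gx].
  - by rewrite dvdn_div.
  - have [ai ri] := xar _ ix; have /andP[i_0 iN] := bnd _ ix.
    (* Here [h] divides both [a] and [r], hence [i]; with the coprime factor [N %/ h] this gives
       [N %| i], against [0 < i < N]. *)
    apply/negP=> si; suff : N %/ h * h %| i by rewrite divnK // gtnNdvd.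
    rewrite Gauss_dvd ?coprime_divn_squarefree // si.
    by rewrite -(subnK ai) dvdn_add // (dvdn_trans hr).
  - have [_ gr] := gar _ gx; apply: (cop h) => //.
    by rewrite dvdn_gcd gr (dvdn_trans gs) ?dvdn_div.
pose s := h %/ gcdn h a.
have hah : gcdn h a %| h := dvdn_gcdl _ _.
have sh : s %| h by rewrite dvdn_div.
(* Such a [g] divides both [gcdn h a] and its cofactor in [N], and these are coprime. *)
have scop g : g %| s -> g %| a -> g = 1.
  move=> gs ga; apply: (cop (gcdn h a)); first exact: dvdn_trans hN.
    by rewrite -(divnK hN) -muln_divA // dvdn_mull.
  by rewrite dvdn_gcd ga (dvdn_trans gs).
apply: (@ap_complement_multiples x s) => // [|i ix|g gs /gar[ga _]].
- exact: dvdn_trans hN.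
- have [ai ri] := xar _ ix; apply/negP=> si.
  (* As [s] divides [r], it divides [i - a], hence [a]; then [s = 1], so [h = gcdn h a] divides [a],
     a contradiction. *)
  have sa : s %| a.
    rewrite -(dvdn_addr _ (dvdn_trans (dvdn_trans sh hr) ri)).
    by rewrite subnK.
  have s1 := scop s (dvdnn _) sa; move/negP: ha; apply.
  have := divnK hah; rewrite -/s s1 mul1n => <-; exact: dvdn_gcdr.
- exact: scop.
Qed.

Lemma ap_complemented : 0 < N -> squarefree N -> complemented (APlattice N.+1).
Proof.
move=> N0 sqN x.
have [x0|x0] := boolP (ord0 \in val x);
  have [xN|xN] := boolP (ord_max \in val x).
- exact: ap_complement_ends.
- exact: ap_complement_left.
- exact: ap_complement_right.
have [xb|/set0Pn[i0 xi0]] := eqVneq (val x) set0.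
  exists \top; rewrite /complement joinx1 meetx1; split=> //.
  exact/val_inj.
exact: ap_complement_interior xi0 x0 xN.
Qed.

End Join.

Theorem theorem13 (n : nat) (hn : (2 <= n)%N) :
  (complemented (APlattice n) <-> squarefree (n - 1)%N) /\
  (~ squarefree (n - 1)%N ->
     exists x : APlattice n,
       [/\ x <> \bot, x <> \top &
           forall y : APlattice n, upper_semicomplement x y <-> y = \top]).
Proof.
case: n hn => [//|N N0]; rewrite subn1 /=.
split; first split=> [compl d dN|]; last 1 first.
- move=> nsq.
  (* Any [d] with [d ^ 2 %| N] is at most [N], so a bounded, decidable search yields the witness. *)
  have [/existsP[d /andP[dN d1]]|] :=
      boolP [exists d : 'I_N.+1, (d ^ 2 %| N)%N && (d != 1%N :> nat)].
    exact: unique_upper_semicomplement N0 dN d1.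
  rewrite negb_exists => /forallP sq; case: nsq => d dN.
  have dN1 : (d < N.+1)%N.
    rewrite ltnS; apply: leq_trans (dvdn_leq N0 dN).
    by rewrite expnS expn1; nia.
  by have := sq (Ordinal dN1); rewrite /= dN /= negbK => /eqP.
- apply/eqP; apply: contraT => d1.
  (* A complement of this [x] must be the top, but [x] meets the top in [x], which is not the
     bottom. *)
  have [x [xb _ xt]] := unique_upper_semicomplement N0 dN d1.
  have [y [/xt-> ]] := compl x.
  by rewrite meetx1.
- exact: ap_complemented.
Qed.
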